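(* Let $\gamma_0 := 2+\log 4$, let $\gamma_0 < \gamma \le 4$, and put $\delta := (\gamma-\gamma_0)/8$. Then for every integer $n\ge 1$ and every $f \in \mathcal{T}_n$, $$|f(0)| \le \gamma^{1/2}\left(1+\delta^{-2}e^{-\delta\gamma n}\right)^{1/2}\, n\, \|f\|_{L_2[0,1]}.$$
   Context: For an integer $n\ge1$, $\mathcal{T}_n$ denotes the set of all functions $f:\mathbb{R}\to\mathbb{C}$ of the form $f(t)=\sum_{j=1}^n a_j e^{i\lambda_j t}$ with $a_j\in\mathbb{C}$ (possibly zero) and real exponents $\lambda_1<\lambda_2<\cdots<\lambda_n$. $\|f\|_{L_2[0,1]} = (\int_0^1 |f(t)|^2\,dt)^{1/2}$. *)

(* Defs.v *)
From Stdlib Require Import Reals Lra.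
Open Scope R_scope.

Fixpoint sumR (n : nat) (g : nat -> R) : R :=
  match n with
  | O => 0
  | S k => sumR k g + g k
  end.

(* f(t) = sum_{j<n} a_j e^{i lam_j t}, a_j = ar j + i ai j.
   Real and imaginary parts of f(t). *)
Definition expsum_re (n : nat) (ar ai lam : nat -> R) (t : R) : R :=
  sumR n (fun j => ar j * cos (lam j * t) - ai j * sin (lam j * t)).
Definition expsum_im (n : nat) (ar ai lam : nat -> R) (t : R) : R :=
  sumR n (fun j => ar j * sin (lam j * t) + ai j * cos (lam j * t)).

Definition expsum_abs2 (n : nat) (ar ai lam : nat -> R) (t : R) : R :=
  (expsum_re n ar ai lam t)^2 + (expsum_im n ar ai lam t)^2.
Definition expsum_abs (n : nat) (ar ai lam : nat -> R) (t : R) : R :=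
  sqrt (expsum_abs2 n ar ai lam t).

Definition strictly_increasing_upto (n : nat) (lam : nat -> R) : Prop :=
  forall i j : nat, (i < j)%nat -> (j < n)%nat -> lam i < lam j.

Definition gamma0 : R := 2 + ln 4.

(* Main.v *)
Require Import Defs.
From Stdlib Require Import Reals Lra Lia.
From Coquelicot Require Import Coquelicot.
Open Scope R_scope.

(** Put [s = gamma n].  On the half-line with weight [e^(-s t)], evaluation at [0] on sums of [n]
    exponentials has squared norm at most [s n], as one sees by removing the exponentials one at a
    time with Blaschke factors; hence [|f(0)|^2 <= gamma n^2 int_0^oo |f|^2 e^(-s t)].  The part of
    the integral beyond [1] is small: cut the half-line into intervals of length [h = 1/n]; a
    Turan-type extrapolation bounds [|f(t + N h)|] by [3^N] times the largest of the
    [|f(t + k h)|], [k < n], so the interval [[N h, (N+1) h]] contributes at most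
    [(9 e^(-gamma))^N int_0^1 |f|^2], and these bounds for [N >= n] have a geometric sum below
    [delta^(-2) e^(-delta gamma n) int_0^1 |f|^2].  The half-line integral is only used through
    its truncations, with an error [K e^(-s T)] that tends to [0]. *)

(** * Regularity and boundedness of exponential sums *)

Lemma exp_INR_mult (n : nat) (x : R) : exp (INR n * x) = exp x ^ n.
Proof.
  induction n as [|n IH]; [simpl; now rewrite Rmult_0_l, exp_0|].
  rewrite S_INR, Rmult_plus_distr_r, Rmult_1_l, exp_plus, IH; simpl; ring.
Qed.

Lemma exp_le_compat (x y : R) : x <= y -> exp x <= exp y.
Proof. intros [H|H]; [left; now apply exp_increasing|right; now subst]. Qed.

Lemma expsum_abs2_ge0 (n : nat) (ar ai lam : nat -> R) (t : R) :
  0 <= expsum_abs2 n ar ai lam t.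
Proof.
  unfold expsum_abs2.
  pose proof (pow2_ge_0 (expsum_re n ar ai lam t)).
  pose proof (pow2_ge_0 (expsum_im n ar ai lam t)). lra.
Qed.

Lemma ex_derive_sumR (n : nat) (g : nat -> R -> R) (t : R) :
  (forall j, ex_derive (g j) t) -> ex_derive (fun x => sumR n (fun j => g j x)) t.
Proof.
  intros Hg; induction n as [|n IH]; simpl.
  - apply ex_derive_const.
  - apply (ex_derive_plus (fun x => sumR n (fun j => g j x))); auto.
Qed.

Lemma ex_derive_expsum_abs2 (n : nat) (ar ai lam : nat -> R) (t : R) :
  ex_derive (expsum_abs2 n ar ai lam) t.
Proof.
  assert (Hre : ex_derive (expsum_re n ar ai lam) t)
    by (apply ex_derive_sumR; intros; auto_derive; trivial).
  assert (Him : ex_derive (expsum_im n ar ai lam) t)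
    by (apply ex_derive_sumR; intros; auto_derive; trivial).
  unfold expsum_abs2.
  apply (ex_derive_plus (fun x => expsum_re n ar ai lam x ^ 2)
    (fun x => expsum_im n ar ai lam x ^ 2)); now apply ex_derive_pow.
Qed.

(** Bounds the boundary term at [T] uniformly in [T], so that the weight makes it vanish as [T]
    grows. The induction uses |w + z|^2 <= 2 |w|^2 + 2 |z|^2. *)
Lemma expsum_abs2_bounded (n : nat) (ar ai lam : nat -> R) :
  exists K, forall t, expsum_abs2 n ar ai lam t <= K.
Proof.
  induction n as [|n [K HK]].
  - exists 0; intros t. unfold expsum_abs2, expsum_re, expsum_im; simpl; lra.
  - exists (2 * K + 2 * (ar n ^ 2 + ai n ^ 2)); intros t.
    specialize (HK t). unfold expsum_abs2 in *.
    change (expsum_re (S n) ar ai lam t) with (expsum_re n ar ai lam t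
      + (ar n * cos (lam n * t) - ai n * sin (lam n * t))).
    change (expsum_im (S n) ar ai lam t) with (expsum_im n ar ai lam t
      + (ar n * sin (lam n * t) + ai n * cos (lam n * t))).
    generalize dependent (expsum_re n ar ai lam t); intros u.
    generalize dependent (expsum_im n ar ai lam t); intros v HK.
    pose proof (sin2_cos2 (lam n * t)) as H1; unfold Rsqr in H1.
    set (c := cos (lam n * t)) in *; set (s := sin (lam n * t)) in *.
    assert (E : (ar n * c - ai n * s)^2 + (ar n * s + ai n * c)^2 = ar n ^ 2 + ai n ^ 2)
      by (replace (ar n ^ 2 + ai n ^ 2) with ((ar n ^ 2 + ai n ^ 2) * (s * s + c * c))
            by (rewrite H1; ring); ring).
    set (x := ar n * c - ai n * s) in *; set (y := ar n * s + ai n * c) in *.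
    pose proof (pow2_ge_0 (u - x)); pose proof (pow2_ge_0 (v - y)). nra.
Qed.

(** * Point evaluation in the weighted norm *)

(* With coefficients [a_j = (s - i (lam_j - l)) d_j], the sums [f] and [j] over [a] and [d]
   satisfy the complex equation [j' = - f + (s + i l) j]. *)
Lemma is_derive_expsum (s l : R) (n : nat) (ar ai dr di lam : nat -> R) (t : R) :
  (forall j, ar j = s * dr j + (lam j - l) * di j) ->
  (forall j, ai j = s * di j - (lam j - l) * dr j) ->
  is_derive (expsum_re n dr di lam) t
    (- expsum_re n ar ai lam t + s * expsum_re n dr di lam t - l * expsum_im n dr di lam t) /\
  is_derive (expsum_im n dr di lam) t
    (- expsum_im n ar ai lam t + s * expsum_im n dr di lam t + l * expsum_re n dr di lam t).
Proof.
  intros Hr Hi; unfold expsum_re, expsum_im; induction n as [|n [IHr IHi]]; simpl.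
  - split; auto_derive; trivial; ring.
  - split.
    + evar_last.
      * apply (is_derive_plus (fun x => sumR n _)); [exact IHr|].
        auto_derive; [trivial|reflexivity].
      * unfold plus; simpl; rewrite Hr, Hi; ring.
    + evar_last.
      * apply (is_derive_plus (fun x => sumR n _)); [exact IHi|].
        auto_derive; [trivial|reflexivity].
      * unfold plus; simpl; rewrite Hr, Hi; ring.
Qed.

Lemma expsum_sub_scal (s : R) (n : nat) (ar ai dr di lam : nat -> R) (t : R) :
  expsum_re n (fun j => ar j - s * dr j) (fun j => ai j - s * di j) lam t
    = expsum_re n ar ai lam t - s * expsum_re n dr di lam t /\
  expsum_im n (fun j => ar j - s * dr j) (fun j => ai j - s * di j) lam t
    = expsum_im n ar ai lam t - s * expsum_im n dr di lam t.
Proof.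
  unfold expsum_re, expsum_im; induction n as [|n [IHr IHi]]; simpl; split;
    rewrite ?IHr, ?IHi; ring.
Qed.

Lemma ex_RInt_weighted (n : nat) (ar ai lam : nat -> R) (s a b : R) :
  ex_RInt (fun t => expsum_abs2 n ar ai lam t * exp (- (s * t))) a b.
Proof.
  apply (ex_RInt_continuous (V := R_CompleteNormedModule)); intros t _.
  apply (ex_derive_continuous (K := R_AbsRing) (V := R_NormedModule)).
  apply (ex_derive_mult (expsum_abs2 n ar ai lam)); [apply ex_derive_expsum_abs2|].
  auto_derive; trivial.
Qed.

(* Used with [f(0) = g(0) + s j(0)], where [f] has one term more than [g]. *)
Lemma quadratic_step (s n E g1 g2 j1 j2 : R) :
  0 < s -> 0 <= n -> 0 <= E -> g1 ^ 2 + g2 ^ 2 <= s * n * E ->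
  (g1 + s * j1) ^ 2 + (g2 + s * j2) ^ 2 <= s * (n + 1) * (E + s * (j1 ^ 2 + j2 ^ 2)).
Proof.
  intros Hs [Hn|Hn] HE H.
  - apply Rmult_le_reg_l with n; [exact Hn|].
    (* Weighted Cauchy-Schwarz: (n + 1) (g^2 + n s^2 j^2) - n (g + s j)^2 = (g - n s j)^2. *)
    pose proof (pow2_ge_0 (g1 - n * s * j1)); pose proof (pow2_ge_0 (g2 - n * s * j2)).
    apply Rle_trans with ((n + 1) * (g1 ^ 2 + g2 ^ 2 + n * s ^ 2 * (j1 ^ 2 + j2 ^ 2))).
    + nra.
    + apply Rle_trans with ((n + 1) * (s * n * E + n * s ^ 2 * (j1 ^ 2 + j2 ^ 2))).
      * apply Rmult_le_compat_l; lra.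
      * right; ring.
  - subst n.
    (* With n = 0 the hypothesis forces g = 0, and only s^2 |j|^2 is left to bound. *)
    assert (g1 = 0) by nra. assert (g2 = 0) by nra. subst. nra.
Qed.

(* Integrates [(|f|^2 - |g|^2) e^(-s t) = - s (|j|^2 e^(-s t))'] for [f], [j] as in
   [is_derive_expsum] and [g = f - s j]. *)
Lemma RInt_weighted_step (s l : R) (n : nat) (ar ai dr di lam : nat -> R) (T : R) :
  (forall j, ar j = s * dr j + (lam j - l) * di j) ->
  (forall j, ai j = s * di j - (lam j - l) * dr j) ->
  RInt (fun t => expsum_abs2 n ar ai lam t * exp (- (s * t))) 0 T
  = RInt (fun t => expsum_abs2 n (fun j => ar j - s * dr j) (fun j => ai j - s * di j) lam t
                   * exp (- (s * t))) 0 T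
    + s * (expsum_abs2 n dr di lam 0 - expsum_abs2 n dr di lam T * exp (- (s * T))).
Proof.
  intros Hr Hi.
  set (br := fun j => ar j - s * dr j); set (bi := fun j => ai j - s * di j).
  set (F := fun t => expsum_abs2 n ar ai lam t * exp (- (s * t))).
  set (G := fun t => expsum_abs2 n br bi lam t * exp (- (s * t))).
  set (J := fun t => - s * (expsum_abs2 n dr di lam t * exp (- (s * t)))).
  assert (HJ : is_RInt (fun t => minus (F t) (G t)) 0 T (minus (J T) (J 0))).
  { apply (is_RInt_derive (V := R_CompleteNormedModule)).
    - intros t _.
      destruct (is_derive_expsum s l n ar ai dr di lam t Hr Hi) as [Hp Hq].
      destruct (expsum_sub_scal s n ar ai dr di lam t) as [Eu Ev].
      unfold F, G, J, expsum_abs2, br, bi; rewrite Eu, Ev; clear Eu Ev.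
      generalize dependent (expsum_re n dr di lam); intros p Hp Hq.
      generalize dependent (expsum_im n dr di lam); intros q Hp Hq.
      auto_derive.
      + repeat split; eexists; eassumption.
      + apply is_derive_unique in Hp; apply is_derive_unique in Hq.
        change (Derive (fun x => p x) t) with (Derive p t).
        change (Derive (fun x => q x) t) with (Derive q t).
        rewrite Hp, Hq.
        unfold minus, plus, opp; simpl; ring.
    - intros t _.
      apply (ex_derive_continuous (K := R_AbsRing) (V := R_NormedModule)).
      unfold F, G.
      apply (ex_derive_minus (V := R_NormedModule));
        (apply (ex_derive_mult (expsum_abs2 n _ _ lam));
          [apply ex_derive_expsum_abs2 | auto_derive; trivial]). }
  apply (is_RInt_unique (V := R_CompleteNormedModule)) in HJ.
  rewrite (RInt_minus (V := R_CompleteNormedModule) F G) in HJ by apply ex_RInt_weighted.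
  unfold J, minus, plus, opp in HJ; simpl in HJ.
  replace (- (s * 0)) with 0 in HJ by ring; rewrite exp_0 in HJ.
  change (RInt F 0 T = RInt G 0 T + s * (expsum_abs2 n dr di lam 0
    - expsum_abs2 n dr di lam T * exp (- (s * T)))). lra.
Qed.

(** Induction on [n]: passing from f to g = f - s j multiplies each coefficient by the Blaschke
    factor - i (lam_j - l) / (s - i (lam_j - l)). This removes the exponent l, and the weighted
    energy drops by s |j(0)|^2 up to the boundary term at [T]. The constant [K] collects these
    boundary terms. *)
Lemma abs2_0_le_weighted (s : R) (n : nat) (ar ai lam : nat -> R) :
  0 < s ->
  exists K, 0 <= K /\ forall T, 0 <= T ->
    expsum_abs2 n ar ai lam 0 <= s * INR n *
      (RInt (fun t => expsum_abs2 n ar ai lam t * exp (- (s * t))) 0 T + K * exp (- (s * T))).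
Proof.
  intros Hs; revert ar ai; induction n as [|n IH]; intros ar ai.
  - exists 0; split; [lra|]; intros T _.
    unfold expsum_abs2, expsum_re, expsum_im; simpl; lra.
  - set (l := lam n).
    (* Real and imaginary parts of d_j = a_j / (s - i (lam_j - l)). *)
    set (dr := fun j => (ar j * s - ai j * (lam j - l)) / (s ^ 2 + (lam j - l) ^ 2)).
    set (di := fun j => (ar j * (lam j - l) + ai j * s) / (s ^ 2 + (lam j - l) ^ 2)).
    assert (Hden : forall j, s ^ 2 + (lam j - l) ^ 2 <> 0)
      by (intros j; pose proof (pow2_ge_0 (lam j - l)); nra).
    assert (Hr : forall j, ar j = s * dr j + (lam j - l) * di j)
      by (intros j; unfold dr, di; field; apply Hden).
    assert (Hi : forall j, ai j = s * di j - (lam j - l) * dr j)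
      by (intros j; unfold dr, di; field; apply Hden).
    set (br := fun j => ar j - s * dr j); set (bi := fun j => ai j - s * di j).
    (* b_j = - i (lam_j - l) d_j vanishes at j = n, so the induction hypothesis applies to g. *)
    assert (Hb : forall t, expsum_abs2 (S n) br bi lam t = expsum_abs2 n br bi lam t).
    { intros t; unfold expsum_abs2.
      assert (Er : br n = 0) by (unfold br; rewrite (Hr n); unfold l; ring).
      assert (Ei : bi n = 0) by (unfold bi; rewrite (Hi n); unfold l; ring).
      unfold expsum_re, expsum_im; simpl; rewrite Er, Ei; ring. }
    destruct (IH br bi) as [K [HK0 HK]].
    destruct (expsum_abs2_bounded (S n) dr di lam) as [B HB].
    pose proof (Rle_trans _ _ _ (expsum_abs2_ge0 _ _ _ _ _) (HB 0)) as HB0.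
    (* [s * B] pays for the new boundary term s |j(T)|^2 e^(-s T). *)
    exists (K + s * B); split; [nra|]; intros T HT.
    specialize (HK T HT).
    rewrite (RInt_weighted_step s l (S n) ar ai dr di lam T Hr Hi).
    fold br bi.
    rewrite (RInt_ext _ (fun t => expsum_abs2 n br bi lam t * exp (- (s * t))))
      by (intros t _; now rewrite Hb).
    set (I := RInt _ 0 T) in *.
    assert (HI : 0 <= I).
    { apply RInt_ge_0; [exact HT|apply ex_RInt_weighted|]; intros t _.
      apply Rmult_le_pos; [apply expsum_abs2_ge0|apply Rlt_le, exp_pos]. }
    pose proof (exp_pos (- (s * T))) as He.
    destruct (expsum_sub_scal s (S n) ar ai dr di lam 0) as [Eu Ev].
    rewrite S_INR, <- (Hb 0) in *.
    pose proof (quadratic_step s (INR n) (I + K * exp (- (s * T)))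
      (expsum_re (S n) br bi lam 0) (expsum_im (S n) br bi lam 0)
      (expsum_re (S n) dr di lam 0) (expsum_im (S n) dr di lam 0)
      Hs (pos_INR n) ltac:(nra) HK) as Hstep.
    fold br bi in Eu, Ev.
    replace (expsum_re (S n) br bi lam 0 + s * expsum_re (S n) dr di lam 0)
      with (expsum_re (S n) ar ai lam 0) in Hstep by (rewrite Eu; ring).
    replace (expsum_im (S n) br bi lam 0 + s * expsum_im (S n) dr di lam 0)
      with (expsum_im (S n) ar ai lam 0) in Hstep by (rewrite Ev; ring).
    eapply Rle_trans; [exact Hstep|].
    apply Rmult_le_compat_l; [pose proof (pos_INR n); nra|].
    change (expsum_re (S n) dr di lam 0 ^ 2 + expsum_im (S n) dr di lam 0 ^ 2)
      with (expsum_abs2 (S n) dr di lam 0).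
    assert (s * (expsum_abs2 (S n) dr di lam T * exp (- (s * T))) <= s * (B * exp (- (s * T)))).
    { apply Rmult_le_compat_l; [lra|]. apply Rmult_le_compat_r; [lra|apply HB]. }
    lra.
Qed.

(** * Turan-type extrapolation along equally spaced points *)

(* Coefficients of [f (t + h) - e^(i l h) f t]. *)
Definition shift_re (l h : R) (ar ai lam : nat -> R) (j : nat) : R :=
  ar j * (cos (lam j * h) - cos (l * h)) - ai j * (sin (lam j * h) - sin (l * h)).
Definition shift_im (l h : R) (ar ai lam : nat -> R) (j : nat) : R :=
  ar j * (sin (lam j * h) - sin (l * h)) + ai j * (cos (lam j * h) - cos (l * h)).

(** Complex-valued form, which gives access to the triangle inequality and multiplicativity of
    [Cmod]. *)
Definition expsum (n : nat) (ar ai lam : nat -> R) (t : R) : C :=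
  (expsum_re n ar ai lam t, expsum_im n ar ai lam t).

Lemma expsum_shift (l h : R) (n : nat) (ar ai lam : nat -> R) (t : R) :
  expsum n ar ai lam (t + h)
  = Cplus (Cmult (cos (l * h), sin (l * h)) (expsum n ar ai lam t))
      (expsum n (shift_re l h ar ai lam) (shift_im l h ar ai lam) lam t).
Proof.
  unfold expsum, Cplus, Cmult; simpl; f_equal; unfold expsum_re, expsum_im;
    (induction n as [|n IH]; simpl; [ring|]; rewrite IH; clear IH;
     unfold shift_re, shift_im;
     rewrite (Rmult_plus_distr_l (lam n)), cos_plus, sin_plus; ring).
Qed.

Lemma Cmod_cis (x : R) : Cmod (cos x, sin x) = 1.
Proof.
  unfold Cmod; simpl.
  replace (cos x * (cos x * 1) + sin x * (sin x * 1)) with 1; [apply sqrt_1|].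
  pose proof (sin2_cos2 x) as H; unfold Rsqr in H; lra.
Qed.

(* Induction on the number of exponents: [g t = f (t + h) - e^(i l h) f t] has one term less,
   is at most [2 M] at the first nodes, and [1 + 2 (1 + 3 + ... + 3^(N-1)) = 3^N]. *)
Lemma expsum_extrapolation (h M : R) (n : nat) (ar ai lam : nat -> R) (t : R) :
  0 <= M ->
  (forall k, (k < n)%nat -> Cmod (expsum n ar ai lam (t + INR k * h)) <= M) ->
  forall N, Cmod (expsum n ar ai lam (t + INR N * h)) <= 3 ^ N * M.
Proof.
  revert M ar ai; induction n as [|n IH]; intros M ar ai HM Hk N.
  - unfold expsum, expsum_re, expsum_im; simpl.
    change (0, 0) with (RtoC 0); rewrite Cmod_0.
    apply Rmult_le_pos; [apply pow_le; lra|exact HM].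
  - set (br := shift_re (lam n) h ar ai lam); set (bi := shift_im (lam n) h ar ai lam).
    set (f := fun k => expsum (S n) ar ai lam (t + INR k * h)).
    set (g := fun k => expsum n br bi lam (t + INR k * h)).
    set (z := (cos (lam n * h), sin (lam n * h)) : C).
    assert (Hz : Cmod z = 1) by apply Cmod_cis.
    assert (Hfg : forall k, f (S k) = Cplus (Cmult z (f k)) (g k)).
    { intros k; unfold f, g.
      replace (t + INR (S k) * h) with (t + INR k * h + h) by (rewrite S_INR; ring).
      rewrite (expsum_shift (lam n) h (S n)); fold br bi z; f_equal.
      (* With l = lam_n the shifted coefficient of index [n] is zero, so the last term drops out. *)
      unfold expsum, expsum_re, expsum_im; simpl; f_equal;
        unfold br, bi, shift_re, shift_im; ring. }
    assert (Hg : forall N, Cmod (g N) <= 3 ^ N * (2 * M)).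
    { apply IH; [lra|]; intros k Hkn; change (Cmod (g k) <= 2 * M).
      replace (g k) with (Cplus (f (S k)) (Copp (Cmult z (f k)))) by (rewrite Hfg; ring).
      eapply Rle_trans; [apply Cmod_triangle|].
      rewrite Cmod_opp, Cmod_mult, Hz.
      pose proof (Hk (S k) ltac:(lia)); pose proof (Hk k ltac:(lia)).
      unfold f; lra. }
    change (Cmod (f N) <= 3 ^ N * M).
    induction N as [|N IHN].
    + simpl; rewrite Rmult_1_l; apply (Hk 0%nat); lia.
    + rewrite Hfg; eapply Rle_trans; [apply Cmod_triangle|].
      rewrite Cmod_mult, Hz; specialize (Hg N); simpl; lra.
Qed.

Lemma sumR_ge_term (n : nat) (g : nat -> R) (k : nat) :
  (forall j, 0 <= g j) -> (k < n)%nat -> g k <= sumR n g.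
Proof.
  intros Hg; induction n as [|n IH]; intros Hk; [lia|]; simpl.
  assert (H0 : 0 <= sumR n g).
  { clear IH Hk; induction n; simpl; [lra|]; pose proof (Hg n); lra. }
  destruct (Nat.eq_dec k n) as [->|Hne]; [lra|].
  pose proof (Hg n); pose proof (IH ltac:(lia)); lra.
Qed.

(** The maximum over the first nodes is replaced by a sum of squares, which can be integrated in
    [t]; squaring turns 3^N into 9^N. *)
Lemma expsum_abs2_extrapolation (h : R) (n : nat) (ar ai lam : nat -> R) (t : R) (N : nat) :
  expsum_abs2 n ar ai lam (t + INR N * h)
  <= 9 ^ N * sumR n (fun k => expsum_abs2 n ar ai lam (t + INR k * h)).
Proof.
  set (A := sumR n _).
  assert (Habs : forall x, Cmod (expsum n ar ai lam x) = sqrt (expsum_abs2 n ar ai lam x))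
    by reflexivity.
  assert (H := expsum_extrapolation h (sqrt A) n ar ai lam t (sqrt_pos _)).
  assert (Hk : forall k, (k < n)%nat -> Cmod (expsum n ar ai lam (t + INR k * h)) <= sqrt A).
  { intros k Hkn; rewrite Habs; apply sqrt_le_1_alt.
    apply (sumR_ge_term n (fun k => expsum_abs2 n ar ai lam (t + INR k * h)));
      [intros; apply expsum_abs2_ge0|exact Hkn]. }
  specialize (H Hk N); rewrite Habs in H.
  assert (HA : 0 <= A).
  { unfold A; clear. generalize n at 1; intros m; induction m; simpl; [lra|].
    pose proof (expsum_abs2_ge0 n ar ai lam (t + INR m * h)); lra. }
  apply (fun H' => pow_incr _ _ 2 (conj (sqrt_pos _) H')) in H.
  rewrite pow2_sqrt, Rpow_mult_distr, pow2_sqrt, <- pow_mult, Nat.mul_comm, pow_mult in H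
    by (apply expsum_abs2_ge0 || exact HA).
  now replace (3 ^ 2) with 9 in H by ring.
Qed.

(** * Integrals over blocks of length [h] and the tail *)

Lemma continuous_expsum_abs2 (n : nat) (ar ai lam : nat -> R) (t : R) :
  continuous (expsum_abs2 n ar ai lam) t.
Proof.
  apply (ex_derive_continuous (K := R_AbsRing) (V := R_NormedModule)).
  apply ex_derive_expsum_abs2.
Qed.

Lemma ex_RInt_translate (F : R -> R) (v a b : R) :
  (forall t, continuous F t) -> ex_RInt (fun x => F (x + v)) a b.
Proof.
  intros HF; apply (ex_RInt_continuous (V := R_CompleteNormedModule)); intros t _.
  apply (continuous_comp (fun x => x + v) F); [|apply HF].
  apply (ex_derive_continuous (K := R_AbsRing) (V := R_NormedModule)).
  auto_derive; trivial.
Qed.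

Lemma RInt_translate (F : R -> R) (v a b : R) :
  (forall t, continuous F t) -> RInt (fun x => F (x + v)) a b = RInt F (a + v) (b + v).
Proof.
  intros HF.
  pose proof (RInt_comp_lin (V := R_CompleteNormedModule) F 1 v a b) as H.
  rewrite !Rmult_1_l in H; rewrite <- H.
  - apply RInt_ext; intros x _; unfold scal; simpl; unfold mult; simpl.
    now rewrite !Rmult_1_l.
  - apply (ex_RInt_continuous (V := R_CompleteNormedModule)); auto.
Qed.

(** The blocks [k h, (k+1) h] with k < m tile [0, m h], and each is translated back to [0, h]. *)
Lemma RInt_sum_translates (F : R -> R) (h : R) (m : nat) :
  (forall t, continuous F t) ->
  is_RInt (fun x => sumR m (fun k => F (x + INR k * h))) 0 h (RInt F 0 (INR m * h)).
Proof.
  intros HF; induction m as [|m IH].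
  - simpl; rewrite Rmult_0_l, RInt_point.
    pose proof (is_RInt_const (V := R_NormedModule) 0 h 0) as H.
    now rewrite (scal_zero_r (V := R_NormedModule)) in H.
  - assert (HI : forall a b, ex_RInt F a b)
      by (intros; apply (ex_RInt_continuous (V := R_CompleteNormedModule)); auto).
    rewrite <- (RInt_Chasles F 0 (INR m * h)) by apply HI.
    apply (is_RInt_plus (V := R_NormedModule) (fun x => sumR m _)); [exact IH|].
    replace (RInt F (INR m * h) (INR (S m) * h))
      with (RInt (fun x => F (x + INR m * h)) 0 h).
    + apply (RInt_correct (V := R_CompleteNormedModule)), ex_RInt_translate, HF.
    + rewrite RInt_translate by exact HF; f_equal; rewrite ?S_INR; ring.
Qed.

Lemma RInt_expsum_abs2_extrapolation (h : R) (n : nat) (ar ai lam : nat -> R) (N : nat) :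
  0 <= h ->
  RInt (expsum_abs2 n ar ai lam) (INR N * h) (INR (S N) * h)
  <= 9 ^ N * RInt (expsum_abs2 n ar ai lam) 0 (INR n * h).
Proof.
  intros Hh.
  set (F := expsum_abs2 n ar ai lam).
  assert (HF : forall t, continuous F t) by apply continuous_expsum_abs2.
  pose proof (is_RInt_scal (V := R_NormedModule) _ _ _ (9 ^ N) _
    (RInt_sum_translates F h n HF)) as Hsum.
  replace (RInt F (INR N * h) (INR (S N) * h))
    with (RInt (fun x => F (x + INR N * h)) 0 h)
    by (rewrite RInt_translate by exact HF; f_equal; rewrite ?S_INR; ring).
  apply (is_RInt_le (fun x => F (x + INR N * h)) _ 0 h) with (3 := Hsum); [exact Hh| |].
  - apply (RInt_correct (V := R_CompleteNormedModule)), ex_RInt_translate, HF.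
  - intros x _; apply expsum_abs2_extrapolation.
Qed.

(** On [0, 1] the weight is at most 1. On the block starting at N h it is at most e^(-c N), against
    the growth 9^N, so the blocks from n to n + M - 1 add up to a geometric sum in [q]. *)
Lemma weighted_RInt_le (c h : R) (n : nat) (ar ai lam : nat -> R) (M : nat) :
  0 <= c -> 0 < h -> INR n * h = 1 ->
  let q := 9 * exp (- c) in
  q < 1 ->
  RInt (fun t => expsum_abs2 n ar ai lam t * exp (- (c / h * t))) 0 (INR (n + M) * h)
  <= (1 + (q ^ n - q ^ (n + M)) / (1 - q)) * RInt (expsum_abs2 n ar ai lam) 0 1.
Proof.
  intros Hc Hh Hnh q Hq.
  set (F := expsum_abs2 n ar ai lam).
  assert (HF : forall a b, ex_RInt F a b)
    by (intros; apply (ex_RInt_continuous (V := R_CompleteNormedModule));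
        intros; apply continuous_expsum_abs2).
  assert (HW : forall a b, ex_RInt (fun t => F t * exp (- (c / h * t))) a b)
    by (intros; apply ex_RInt_weighted).
  assert (Hblock : forall a b x, a <= b -> x <= a ->
    RInt (fun t => F t * exp (- (c / h * t))) a b <= exp (- (c / h * x)) * RInt F a b).
  { intros a b x Hab Hxa.
    change (exp (- (c / h * x)) * RInt F a b) with (scal (exp (- (c / h * x))) (RInt F a b)).
    rewrite <- (RInt_scal (V := R_CompleteNormedModule)) by apply HF.
    apply RInt_le; [exact Hab|apply HW|apply (ex_RInt_scal (V := R_NormedModule)), HF|].
    intros t Ht; unfold scal; simpl; unfold mult; simpl.
    rewrite Rmult_comm; apply Rmult_le_compat_r; [apply expsum_abs2_ge0|].
    assert (Hch : 0 <= c / h) by (apply Rdiv_le_0_compat; lra).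
    assert (H : c / h * x <= c / h * t) by (apply Rmult_le_compat_l; lra).
    apply exp_le_compat; lra. }
  induction M as [|M IH].
  - rewrite Nat.add_0_r, Hnh.
    eapply Rle_trans; [apply (Hblock 0 1 0); lra|].
    rewrite Rmult_0_r, Ropp_0, exp_0; right; field; lra.
  - rewrite Nat.add_succ_r.
    rewrite <- (RInt_Chasles _ 0 (INR (n + M) * h)) by apply HW.
    set (N := (n + M)%nat) in *.
    assert (Hlast : RInt (fun t => F t * exp (- (c / h * t))) (INR N * h) (INR (S N) * h)
                    <= q ^ N * RInt F 0 1).
    { eapply Rle_trans;
        [apply (Hblock _ _ (INR N * h)); [rewrite S_INR; nra|lra]|].
      replace (c / h * (INR N * h)) with (INR N * c) by (field; lra).
      replace (exp (- (INR N * c))) with (exp (- c) ^ N)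
        by (rewrite <- exp_INR_mult; f_equal; ring).
      unfold q; rewrite Rpow_mult_distr, (Rmult_comm (9 ^ N)), Rmult_assoc.
      apply Rmult_le_compat_l; [apply pow_le, Rlt_le, exp_pos|].
      rewrite <- Hnh; apply RInt_expsum_abs2_extrapolation; lra. }
    unfold plus; simpl.
    apply Rle_trans with (1 := Rplus_le_compat _ _ _ _ IH Hlast).
    (* The geometric sum telescopes: (q^n - q^N) + q^N (1 - q) = q^n - q^(N+1). *)
    right; simpl; field; lra.
Qed.

(** Since gamma = 2 + ln 4 + 8 delta, q = 9 e^(-2) e^(-8 delta) / 4, and e^2 >= 4 gives q <= (9/16)
    e^(-8 delta). *)
Lemma tail_constant_le (gamma : R) (n : nat) :
  gamma0 < gamma -> gamma <= 4 ->
  let delta := (gamma - gamma0) / 8 in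
  let q := 9 * exp (- gamma) in
  0 < q < 1 /\ q ^ n / (1 - q) <= / delta ^ 2 * exp (- (delta * gamma * INR n)).
Proof.
  intros H0 H1 delta q.
  assert (Hln : 1 <= ln 4).
  { apply Rnot_lt_le; intros Hlt; apply exp_increasing in Hlt; rewrite exp_ln in Hlt by lra.
    pose proof exp_le_3; lra. }
  (* [gamma0] is at least 3 and [gamma] at most 4. *)
  assert (Hd : 0 < delta <= 1 / 8) by (unfold delta, gamma0 in *; lra).
  assert (He2 : exp (-2) <= / 4).
  { replace (exp (-2)) with (/ (exp 1 * exp 1))
      by (rewrite <- exp_plus, <- exp_Ropp; f_equal; ring).
    pose proof (exp_ineq1_le 1). apply Rinv_le_contravar; [lra|nra]. }
  assert (Hq : q <= 9 / 16 * exp (- (8 * delta))).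
  { unfold q.
    replace (- gamma) with (-2 + (- ln 4 + - (8 * delta)))
      by (unfold delta, gamma0; field).
    rewrite !exp_plus, (exp_Ropp (ln 4)), exp_ln by lra.
    pose proof (exp_pos (- (8 * delta))); nra. }
  assert (Hq1 : q <= 9 / 16).
  { pose proof (exp_le_compat (- (8 * delta)) 0 ltac:(lra)) as H; rewrite exp_0 in H; lra. }
  (* Uses delta gamma <= 8 delta, from gamma <= 4. *)
  assert (Hq2 : q <= exp (- (delta * gamma))).
  { pose proof (exp_le_compat (- (8 * delta)) (- (delta * gamma)) ltac:(nra)).
    pose proof (exp_pos (- (8 * delta))); lra. }
  assert (Hq0 : 0 < q) by (unfold q; pose proof (exp_pos (- gamma)); lra).
  split; [lra|].
  unfold Rdiv; rewrite Rmult_comm; apply Rmult_le_compat.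
  - left; apply Rinv_0_lt_compat; lra.
  - apply pow_le; lra.
  (* delta^2 <= 1/64 < 7/16 <= 1 - q. *)
  - apply Rinv_le_contravar; nra.
  - replace (- (delta * gamma * INR n)) with (INR n * - (delta * gamma)) by ring.
    rewrite exp_INR_mult; apply pow_incr; lra.
Qed.

(** * Passage to the limit and conclusion *)

Lemma le_of_le_add_geom (x y K r : R) :
  0 <= r < 1 -> (forall M : nat, x <= y + K * r ^ M) -> x <= y.
Proof.
  intros Hr H.
  apply (is_lim_seq_le (fun _ => x) (fun M => y + K * r ^ M) x y H).
  - apply is_lim_seq_const.
  - replace y with (y + K * 0) at 1 by ring.
    apply is_lim_seq_plus'; [apply is_lim_seq_const|].
    apply (is_lim_seq_scal_l _ K 0), is_lim_seq_geom.
    rewrite Rabs_pos_eq; lra.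
Qed.

Theorem theorem2p2 (gamma : R) (hg0 : gamma0 < gamma) (hg1 : gamma <= 4)
  (n : nat) (hn : (1 <= n)%nat) (ar ai lam : nat -> R)
  (hlam : strictly_increasing_upto n lam)
  (pr : Riemann_integrable (expsum_abs2 n ar ai lam) 0 1) :
  let delta := (gamma - gamma0) / 8 in
  expsum_abs n ar ai lam 0
    <= sqrt gamma * sqrt (1 + / delta ^ 2 * exp (- (delta * gamma * INR n)))
       * INR n * sqrt (RiemannInt pr).
Proof.
  intros delta.
  rewrite <- (RInt_Reals _ _ _ pr).
  destruct (tail_constant_le gamma n hg0 hg1) as [Hq Htail]; fold delta in Htail.
  set (q := 9 * exp (- gamma)) in *.
  set (D := / delta ^ 2 * exp (- (delta * gamma * INR n))) in *.
  set (I := RInt (expsum_abs2 n ar ai lam) 0 1).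
  assert (Hn : 0 < INR n) by (apply lt_0_INR; lia).
  assert (Hg : 0 < gamma).
  { unfold gamma0 in hg0.
    assert (0 < ln 4) by (rewrite <- ln_1; apply ln_increasing; lra). lra. }
  assert (HI : 0 <= I).
  { apply RInt_ge_0; [lra| |intros; apply expsum_abs2_ge0].
    apply (ex_RInt_continuous (V := R_CompleteNormedModule)).
    intros; apply continuous_expsum_abs2. }
  assert (HD : 0 <= D).
  { eapply Rle_trans; [|exact Htail].
    apply Rdiv_le_0_compat; [apply pow_le; lra|lra]. }
  assert (Hh : 0 < / INR n) by now apply Rinv_0_lt_compat.
  assert (Hgn : 0 < gamma / / INR n) by now apply Rdiv_lt_0_compat.
  (* The rate s = gamma n is written [gamma / / INR n] to match [c / h] with c = gamma and h =
     1/n. *)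
  destruct (abs2_0_le_weighted (gamma / / INR n) n ar ai lam Hgn) as [K [HK0 HK]].
  assert (Hmain : expsum_abs2 n ar ai lam 0 <= gamma * INR n ^ 2 * ((1 + D) * I)).
  { replace (gamma * INR n ^ 2) with (gamma / / INR n * INR n) by (field; lra).
    apply (le_of_le_add_geom _ _ (gamma / / INR n * INR n * (K * exp (- gamma) ^ n))
      (exp (- gamma))).
    { unfold q in Hq; lra. }
    intros M.
    (* Truncating at T = (n + M)/n gives s T = gamma (n + M), so the error is geometric in [M]. *)
    eapply Rle_trans; [apply (HK (INR (n + M) * / INR n))|].
    { apply Rmult_le_pos; [apply pos_INR|lra]. }
    rewrite (Rmult_assoc (gamma / / INR n * INR n) _ (exp (- gamma) ^ M)),
      <- Rmult_plus_distr_l.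
    apply Rmult_le_compat_l; [nra|].
    apply Rplus_le_compat.
    - eapply Rle_trans.
      + apply (weighted_RInt_le gamma (/ INR n)); [lra|lra|field; lra|fold q; lra].
      + fold q I; apply Rmult_le_compat_r; [exact HI|].
        apply Rplus_le_compat_l; eapply Rle_trans; [|exact Htail].
        apply Rmult_le_compat_r; [left; apply Rinv_0_lt_compat; lra|].
        pose proof (pow_le q (n + M)); lra.
    - right; rewrite Rmult_assoc, <- pow_add, <- exp_INR_mult; do 2 f_equal; field; lra. }
  unfold expsum_abs.
  (* All factors are gathered under one square root, which reduces the claim to [Hmain]. *)
  rewrite <- (sqrt_pow2 (INR n)) by lra.
  assert (Hn2 := pow2_ge_0 (INR n)).
  assert (HgD : 0 <= gamma * (1 + D)) by (apply Rmult_le_pos; lra).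
  rewrite <- (sqrt_mult gamma), <- (sqrt_mult _ (INR n ^ 2)), <- sqrt_mult
    by (try apply Rmult_le_pos; lra).
  apply sqrt_le_1_alt; lra.
Qed.
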